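(* Let $\mathcal{G}\subseteq\mathcal{A}$ be a set of $2$-faces of the $n$-cube. The following are equivalent: (a) $\mathcal{G}$ is a gaussoid, i.e. the four axioms (G1)–(G4) are satisfied for $\mathcal{G}$; (b) $\mathcal{G}$ is compatible with all edge trinomials.
   Context: $[n]=\{1,\dots,n\}$. $\mathcal{P}=\{p_I: I\subseteq[n]\}$ and $\mathcal{A}=\{a_{ij|K}: i,j\in[n]\text{ distinct},\,K\subseteq[n]\setminus\{i,j\}\}$ are sets of unknowns, with $a_{ij|K}=a_{ji|K}$. The $p_I$ correspond to the vertices of the $n$-cube. The symbols $a_{ij|K}$ are identified with the $2$-faces $\{I: K\subseteq I\subseteq K\cup\{i,j\}\}$ of the $n$-cube. Concatenation such as $ijL$ denotes $\{i,j\}\cup L$; $a_{ij|\emptyset}$ is written $a_{ij}$. A subset $\mathcal{G}\subseteq\mathcal{A}$ is a gaussoid on $[n]$ if for all pairwise distinct $i,j,k\in[n]$ and all $L\subseteq[n]\setminus\{i,j,k\}$: (G1) $\{a_{ij|L},a_{ik|jL}\}\subset\mathcal{G}$ implies $\{a_{ik|L},a_{ij|kL}\}\subset\mathcal{G}$; (G2) $\{a_{ij|kL},a_{ik|jL}\}\subset\mathcal{G}$ implies $\{a_{ij|L},a_{ik|L}\}\subset\mathcal{G}$; (G3) $\{a_{ij|L},a_{ik|L}\}\subset\mathcal{G}$ implies $\{a_{ij|kL},a_{ik|jL}\}\subset\mathcal{G}$; (G4) $\{a_{ij|L},a_{ij|kL}\}\subset\mathcal{G}$ implies $a_{ik|L}\in\mathcal{G}$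 or $a_{jk|L}\in\mathcal{G}$. The edge trinomials (one for each edge in each $3$-face of the $n$-cube, $12\cdot 2^{n-3}\binom n3$ in total) are the following polynomials, for all pairwise distinct $i,j,k\in[n]$ and $L\subseteq[n]\setminus\{i,j,k\}$: $p_{iL}\,a_{jk|L}-p_L\,a_{jk|iL}-a_{ij|L}\,a_{ik|L}$; $p_{ijL}\,a_{ik|L}-p_{iL}\,a_{ik|jL}-a_{ij|L}\,a_{jk|iL}$; $p_{ijkL}\,a_{ij|L}-p_{ijL}\,a_{ij|kL}-a_{ik|jL}\,a_{jk|iL}$. A subset $\mathcal{G}\subseteq\mathcal{A}$ is incompatible with a polynomial $f\in\mathbb{R}[\mathcal{P}\cup\mathcal{A}]$ if precisely one monomial in $f$ contains no unknown from $\mathcal{G}$. Otherwise $\mathcal{G}$ is compatible with $f$. *)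

(* Defs.v *)
From mathcomp Require Import all_boot all_order all_algebra.
From mathcomp Require Import finmap monalg reals.

Set Implicit Arguments.
Unset Strict Implicit.
Unset Printing Implicit Defensive.

Import GRing.Theory.
Local Open Scope ring_scope.

(* The symbol a_{ij|K} is the pair ({i,j}, K), i.e. the 2-face
   {I : K <= I <= K + {i,j}} of the n-cube; storing the unordered pair makes
   a_{ij|K} = a_{ji|K} hold by construction.  The ground set [n] is 'I_n. *)
Definition is_face2 (n : nat) (EK : {set 'I_n} * {set 'I_n}) : bool :=
  (#|EK.1| == 2)%N && [disjoint EK.1 & EK.2].

Notation face2 n := {EK : {set 'I_n} * {set 'I_n} | is_face2 EK}.

(* p_I is [inl I] and a_{ij|K} is [inr _]. *)
Notation unknown n := ({set 'I_n} + face2 n)%type.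

Notation polyPA R n := {malg R[{cmonom (unknown n)}]}.

Definition var (R : realType) (n : nat) (u : unknown n) : polyPA R n :=
  << ucm u >>.

Lemma is_face2P (n : nat) (i j : 'I_n) (K : {set 'I_n}) :
  [&& i != j, i \notin K & j \notin K] -> is_face2 ([set i; j], K).
Proof.
case/and3P=> ij iK jK; rewrite /is_face2 /= cards2 ij eqxx /=.
by rewrite disjoints_subset; apply/subsetP=> x; rewrite !inE => /orP[]/eqP->.
Qed.

Definition aface (n : nat) (i j : 'I_n) (K : {set 'I_n})
    (h : [&& i != j, i \notin K & j \notin K]) : face2 n :=
  exist _ ([set i; j], K) (is_face2P h).

Definition triple_off (n : nat) (i j k : 'I_n) (L : {set 'I_n}) : bool :=
  [&& i != j, i != k & j != k] && [&& i \notin L, j \notin L & k \notin L].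

Section Cube3.
Context (n : nat) (i j k : 'I_n) (L : {set 'I_n}).
Context (h : triple_off i j k L).

Lemma triple_offP :
  ((i == j = false) * (j == i = false) * (i == k = false) * (k == i = false)
   * (j == k = false) * (k == j = false)
   * (i \in L = false) * (j \in L = false) * (k \in L = false))%type.
Proof.
case/andP: h => /and3P[ij ik jk] /and3P[iL jL kL].
by rewrite ![_ == i]eq_sym ![k == j]eq_sym; do !split; apply: negbTE.
Qed.

Lemma is_face_ij : [&& i != j, i \notin L & j \notin L].
Proof. by rewrite ?inE !triple_offP. Qed.
Lemma is_face_ik : [&& i != k, i \notin L & k \notin L].
Proof. by rewrite ?inE !triple_offP. Qed.
Lemma is_face_jk : [&& j != k, j \notin L & k \notin L].
Proof. by rewrite ?inE !triple_offP. Qed.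
Lemma is_face_ij_k : [&& i != j, i \notin k |: L & j \notin k |: L].
Proof. by rewrite ?inE !triple_offP. Qed.
Lemma is_face_ik_j : [&& i != k, i \notin j |: L & k \notin j |: L].
Proof. by rewrite ?inE !triple_offP. Qed.
Lemma is_face_jk_i : [&& j != k, j \notin i |: L & k \notin i |: L].
Proof. by rewrite ?inE !triple_offP. Qed.

(* [a_xy] is a_{xy|L} and [a_xy_z] is a_{xy|zL}. *)
Definition a_ij : face2 n := aface is_face_ij.
Definition a_ik : face2 n := aface is_face_ik.
Definition a_jk : face2 n := aface is_face_jk.
Definition a_ij_k : face2 n := aface is_face_ij_k.
Definition a_ik_j : face2 n := aface is_face_ik_j.
Definition a_jk_i : face2 n := aface is_face_jk_i.

Context (R : realType).

Local Notation p I := (var R (inl I : unknown n)).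
Local Notation a F := (var R (inr F : unknown n)).

Definition edge_tri1 : polyPA R n :=
  p (i |: L) * a a_jk - p L * a a_jk_i - a a_ij * a a_ik.
Definition edge_tri2 : polyPA R n :=
  p ([set i; j] :|: L) * a a_ik - p (i |: L) * a a_ik_j - a a_ij * a a_jk_i.
Definition edge_tri3 : polyPA R n :=
  p ([set i; j; k] :|: L) * a a_ij - p ([set i; j] :|: L) * a a_ij_k
    - a a_ik_j * a a_jk_i.
End Cube3.

Definition edge_trinomial (R : realType) (n : nat) (f : polyPA R n) : Prop :=
  exists (i j k : 'I_n) (L : {set 'I_n}) (h : triple_off i j k L),
    [\/ f = edge_tri1 h R, f = edge_tri2 h R | f = edge_tri3 h R].

Definition G1 (n : nat) (G : {set face2 n}) : Prop :=
  forall (i j k : 'I_n) (L : {set 'I_n}) (h : triple_off i j k L),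
    [set a_ij h; a_ik_j h] \subset G -> [set a_ik h; a_ij_k h] \subset G.

Definition G2 (n : nat) (G : {set face2 n}) : Prop :=
  forall (i j k : 'I_n) (L : {set 'I_n}) (h : triple_off i j k L),
    [set a_ij_k h; a_ik_j h] \subset G -> [set a_ij h; a_ik h] \subset G.

Definition G3 (n : nat) (G : {set face2 n}) : Prop :=
  forall (i j k : 'I_n) (L : {set 'I_n}) (h : triple_off i j k L),
    [set a_ij h; a_ik h] \subset G -> [set a_ij_k h; a_ik_j h] \subset G.

Definition G4 (n : nat) (G : {set face2 n}) : Prop :=
  forall (i j k : 'I_n) (L : {set 'I_n}) (h : triple_off i j k L),
    [set a_ij h; a_ij_k h] \subset G -> a_ik h \in G \/ a_jk h \in G.

Definition gaussoid (n : nat) (G : {set face2 n}) : Prop :=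
  [/\ G1 G, G2 G, G3 G & G4 G].

Definition avoids (n : nat) (G : {set face2 n}) (m : {cmonom (unknown n)}) :
    bool :=
  [forall g in G, m (inr g) == 0%N].

Definition incompatible (R : realType) (n : nat) (G : {set face2 n})
    (f : polyPA R n) : Prop :=
  #|` [fset m in msupp f | avoids G m]%fset| = 1%N.

Definition compatible (R : realType) (n : nat) (G : {set face2 n})
    (f : polyPA R n) : Prop :=
  ~ incompatible G f.

(* Main.v *)
Require Import Defs.
From mathcomp Require Import all_boot all_order all_algebra.
From mathcomp Require Import finmap monalg reals.

(** Every edge trinomial has the shape [p_A u - p_B v - w x] with [A <> B] and
    [u], [v], [w], [x] unknowns for 2-faces: [u] and [v] are opposite faces of a
    3-face of the cube, while [w] and [x] are adjacent faces of it.  As the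
    unknowns [p_I] are never in [G], the three monomials survive exactly when
    [u], respectively [v], respectively both [w] and [x], lie outside [G].
    Hence [G] is compatible with the trinomial iff no two of the monomials are
    killed without the third ([compatible_trinomial], [kills_consistently]):
    [u] and one of [w], [x] in [G] force [v]; [v] and one of [w], [x] force
    [u]; and [u], [v] force [w] or [x].

    Read this way, the conclusions of (G1)-(G4) for [i, j, k, L] are among the
    clauses for the edges of one 3-face: those of (G1)-(G3) are clauses that
    force [u] or [v], and (G4) is the clause that forces [w] or [x] at the edge
    from [L] to [L] with [k] added ([compatible_gaussoid]).

    Conversely ([gaussoid_compatible]), every clause that forces [u] or [v] is
    an instance of (G1)-(G3) after permuting [i, j, k], and at the three edges
    with vertex [L] the clause that forces [w] or [x] is an instance of (G4).
    At the other edges [w] and [x] do not both have [L] as a vertex; there (G4)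
    yields a face with vertex [L], and (G1), applied to it and to [v], turns it
    into [w] or [x] where it is neither of them. *)

Set Implicit Arguments.
Unset Strict Implicit.
Unset Printing Implicit Defensive.

Import GRing.Theory.

(** * The monomials of a trinomial *)

Section Monomials.
Context (R : realType) (n : nat) (G : {set face2 n}).
Implicit Types (A B : {set 'I_n}) (f u v w x : face2 n).

Lemma var_mul (s t : unknown n) :
  (var R s * var R t)%R = (<< mmul (ucm s) (ucm t) >>)%R.
Proof. by rewrite /var malgM_def fgmulUU mulr1. Qed.

Lemma trinomialE (s1 t1 s2 t2 s3 t3 : unknown n) :
  (var R s1 * var R t1 - var R s2 * var R t2 - var R s3 * var R t3)%R
  = (<< mmul (ucm s1) (ucm t1) >> - << mmul (ucm s2) (ucm t2) >>
     - << mmul (ucm s3) (ucm t3) >>)%R.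
Proof. by congr (_ - _ - _)%R; apply: var_mul. Qed.

Lemma msupp_trinomial (K : choiceType) (S : nzRingType) (m1 m2 m3 : K) :
    m1 != m2 -> m1 != m3 -> m2 != m3 ->
  msupp (<< m1 >> - << m2 >> - << m3 >> : {malg S[K]})%R = [fset m1; m2; m3]%fset.
Proof.
move=> d12 d13 d23.
have supp12 : msupp (<< m1 >> - << m2 >> : {malg S[K]})%R = [fset m1; m2]%fset.
  by rewrite msuppB !msuppU !oner_eq0 // fdisjointX1 inE eq_sym.
rewrite msuppB supp12 !msuppU !oner_eq0 //.
by rewrite fdisjointX1 !inE negb_or ![m3 == _]eq_sym d13.
Qed.

Lemma card_msupp_trinomial (K : choiceType) (S : nzRingType) (P : pred K)
    (m1 m2 m3 : K) :
    m1 != m2 -> m1 != m3 -> m2 != m3 ->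
  #|` [fset m in msupp (<< m1 >> - << m2 >> - << m3 >> : {malg S[K]})%R
      | P m]%fset| = P m1 + P m2 + P m3.
Proof.
move=> d12 d13 d23; rewrite msupp_trinomial //.
have -> : [fset m in [fset m1; m2; m3] | P m]%fset
    = [fset m in filter P [:: m1; m2; m3]]%fset.
  apply/fsetP => m; rewrite [RHS]in_fset [RHS]mem_filter.
  by rewrite !inE andbC orbA.
rewrite card_fseq undup_id ?size_filter /= ?addn0 ?addnA //.
by rewrite (filter_uniq P (s := [:: m1; m2; m3])) //= !inE negb_or d12 d13 d23.
Qed.

Lemma mul_ucmE (I : choiceType) (s t r : I) :
  mmul (ucm s) (ucm t) r = (s == r) + (t == r).
Proof. by rewrite cmM !cmU. Qed.

Lemma mul_ucm_eq0 (I : choiceType) (s t r : I) :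
  (mmul (ucm s) (ucm t) r == 0) = (s != r) && (t != r).
Proof. by rewrite mul_ucmE addn_eq0 !eqb0. Qed.

Lemma mul_ucm_neq (I : choiceType) (s t s' t' : I) :
  s' != s -> t' != s -> mmul (ucm s) (ucm t) != mmul (ucm s') (ucm t').
Proof.
move=> ss' ts'; apply/eqP => /(congr1 (fun m : {cmonom I} => m s)) /eqP.
by rewrite !mul_ucmE eqxx (negbTE ss') (negbTE ts').
Qed.

Lemma avoids_mul_p_a A f :
  avoids G (mmul (ucm (inl A : unknown n)) (ucm (inr f : unknown n)))
    = (f \notin G).
Proof.
apply/forall_inP/idP => [av|fG g gG].
  by apply/negP => /av; rewrite mul_ucm_eq0 eqxx andbF.
rewrite mul_ucm_eq0; apply/andP; split; first by [].
by apply: contraNneq fG => -[->].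
Qed.

Lemma avoids_mul_a_a w x :
  avoids G (mmul (ucm (inr w : unknown n)) (ucm (inr x : unknown n)))
    = (w \notin G) && (x \notin G).
Proof.
apply/forall_inP/andP => [av|[wG xG] g gG].
  by split; apply/negP => /av; rewrite mul_ucm_eq0 eqxx ?andbF.
rewrite mul_ucm_eq0.
by apply/andP; split; [apply: contraNneq wG | apply: contraNneq xG] => -[->].
Qed.

(** For Booleans that say which of [u], [v], [w], [x] lie in [G]: killing two
    of the monomials [p_A u], [p_B v], [w x] always kills the third. *)
Definition kills_consistently (u v w x : bool) : bool :=
  [&& u && (w || x) ==> v, v && (w || x) ==> u & u && v ==> (w || x)].

(** The inequality [A != B] is all that keeps the three monomials distinct,
    whatever [u], [v], [w] and [x] are. *)
Lemma compatible_trinomial A B u v w x : A != B ->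
  compatible G (var R (inl A : unknown n) * var R (inr u : unknown n)
      - var R (inl B : unknown n) * var R (inr v : unknown n)
      - var R (inr w : unknown n) * var R (inr x : unknown n))%R
  <-> kills_consistently (u \in G) (v \in G) (w \in G) (x \in G).
Proof.
move=> AB; rewrite /compatible /incompatible trinomialE card_msupp_trinomial.
- have -> : avoids G (mmul (ucm (inl A)) (ucm (inr u)))
      + avoids G (mmul (ucm (inl B)) (ucm (inr v)))
      + avoids G (mmul (ucm (inr w)) (ucm (inr x)))
      = (u \notin G) + (v \notin G) + ((w \notin G) && (x \notin G)).
    congr (_ + _ + _); congr nat_of_bool.
    + exact: avoids_mul_p_a.
    + exact: avoids_mul_p_a.
    + exact: avoids_mul_a_a.
  rewrite /kills_consistently.
  by case: (u \in G); case: (v \in G); case: (w \in G); case: (x \in G).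
- by apply: mul_ucm_neq; [rewrite eq_sym | ].
- by apply: mul_ucm_neq.
- by apply: mul_ucm_neq.
Qed.

End Monomials.

(** * Gaussoids and edge trinomials by indices *)

Section Indices.
Context (n : nat) (G : {set face2 n}).
Implicit Types (i j k : 'I_n) (K L : {set 'I_n}).

(** Stated on the underlying pairs and not on [face2 n], so that permuting the
    indices does not require transporting proofs that they form a face. *)
Definition mem_face i j K : bool := ([set i; j], K) \in [set val F | F in G].

Lemma mem_faceC i j K : mem_face i j K = mem_face j i K.
Proof. by rewrite /mem_face setUC. Qed.

Lemma in_aface i j K (h : [&& i != j, i \notin K & j \notin K]) :
  (aface h \in G) = mem_face i j K.
Proof. by rewrite /mem_face -(mem_imset _ _ val_inj). Qed.

Lemma triple_off_swap12 i j k L : triple_off i j k L -> triple_off j i k L.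
Proof. by move=> h; rewrite /triple_off !(triple_offP h). Qed.

Lemma triple_off_swap23 i j k L : triple_off i j k L -> triple_off i k j L.
Proof. by move=> h; rewrite /triple_off !(triple_offP h). Qed.

Lemma G1P : G1 G <-> forall i j k L, triple_off i j k L ->
  mem_face i j L -> mem_face i k (j |: L) ->
  mem_face i k L /\ mem_face i j (k |: L).
Proof.
split=> [g i j k L h ij ikj | g i j k L h]; last first.
  by rewrite !subUset !sub1set !in_aface => /andP[ij ikj]; apply/andP/g.
by have := g i j k L h; rewrite !subUset !sub1set !in_aface ij ikj => /(_ isT)/andP.
Qed.

Lemma G2P : G2 G <-> forall i j k L, triple_off i j k L ->
  mem_face i j (k |: L) -> mem_face i k (j |: L) ->
  mem_face i j L /\ mem_face i k L.
Proof.
split=> [g i j k L h ij ikj | g i j k L h]; last first.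
  by rewrite !subUset !sub1set !in_aface => /andP[ij ikj]; apply/andP/g.
by have := g i j k L h; rewrite !subUset !sub1set !in_aface ij ikj => /(_ isT)/andP.
Qed.

Lemma G3P : G3 G <-> forall i j k L, triple_off i j k L ->
  mem_face i j L -> mem_face i k L ->
  mem_face i j (k |: L) /\ mem_face i k (j |: L).
Proof.
split=> [g i j k L h ij ikj | g i j k L h]; last first.
  by rewrite !subUset !sub1set !in_aface => /andP[ij ikj]; apply/andP/g.
by have := g i j k L h; rewrite !subUset !sub1set !in_aface ij ikj => /(_ isT)/andP.
Qed.

Lemma G4P : G4 G <-> forall i j k L, triple_off i j k L ->
  mem_face i j L -> mem_face i j (k |: L) ->
  mem_face i k L \/ mem_face j k L.
Proof.
split=> [g i j k L h ij ijk | g i j k L h]; last first.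
  by rewrite !subUset !sub1set !in_aface => /andP[]; apply: g.
by have := g i j k L h; rewrite !subUset !sub1set !in_aface ij ijk; apply.
Qed.

Context (R : realType).

Let neq_mem i (A B : {set 'I_n}) : i \in A -> i \notin B -> A != B.
Proof. by move=> iA; apply: contraNneq => <-. Qed.

Lemma compatible_edge_tri1 i j k L (h : triple_off i j k L) :
  compatible G (edge_tri1 h R) <->
  kills_consistently (mem_face j k L) (mem_face j k (i |: L))
    (mem_face i j L) (mem_face i k L).
Proof.
rewrite -(in_aface (is_face_jk h)) -(in_aface (is_face_jk_i h))
  -(in_aface (is_face_ij h)) -(in_aface (is_face_ik h)).
apply: compatible_trinomial.
by apply: (@neq_mem i); rewrite ?inE ?eqxx ?(triple_offP h).
Qed.

Lemma compatible_edge_tri2 i j k L (h : triple_off i j k L) :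
  compatible G (edge_tri2 h R) <->
  kills_consistently (mem_face i k L) (mem_face i k (j |: L))
    (mem_face i j L) (mem_face j k (i |: L)).
Proof.
rewrite -(in_aface (is_face_ik h)) -(in_aface (is_face_ik_j h))
  -(in_aface (is_face_ij h)) -(in_aface (is_face_jk_i h)).
apply: compatible_trinomial.
by apply: (@neq_mem j); rewrite ?inE ?eqxx ?orbT // !(triple_offP h).
Qed.

Lemma compatible_edge_tri3 i j k L (h : triple_off i j k L) :
  compatible G (edge_tri3 h R) <->
  kills_consistently (mem_face i j L) (mem_face i j (k |: L))
    (mem_face i k (j |: L)) (mem_face j k (i |: L)).
Proof.
rewrite -(in_aface (is_face_ij h)) -(in_aface (is_face_ij_k h))
  -(in_aface (is_face_ik_j h)) -(in_aface (is_face_jk_i h)).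
apply: compatible_trinomial.
by apply: (@neq_mem k); rewrite ?inE ?eqxx ?orbT // !(triple_offP h).
Qed.

End Indices.

(** * The two sets of conditions compared *)

Lemma kills_consistentlyP (u v w x : bool) :
  reflect [/\ (u -> w \/ x -> v), (v -> w \/ x -> u) & (u -> v -> w \/ x)]
    (kills_consistently u v w x).
Proof.
apply: (iffP and3P) => -[uv vu uvwx]; split.
- by move=> hu /orP hwx; apply: (implyP uv); rewrite hu.
- by move=> hv /orP hwx; apply: (implyP vu); rewrite hv.
- by move=> hu hv; apply/orP; apply: (implyP uvwx); rewrite hu.
- by apply/implyP => /andP[hu /orP]; apply: uv.
- by apply/implyP => /andP[hv /orP]; apply: vu.
- by apply/implyP => /andP[hu hv]; apply/orP; apply: uvwx.
Qed.

(** The case split follows the three clauses of [kills_consistently] for each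
    kind of edge.  Only the last clause at the edges away from [L] takes two
    axioms, (G4) and then (G1). *)
Lemma gaussoid_compatible (R : realType) (n : nat) (G : {set face2 n}) :
  gaussoid G -> forall f : polyPA R n, edge_trinomial f -> compatible G f.
Proof.
move=> [/G1P g1 /G2P g2 /G3P g3 /G4P g4] f [i] [j] [k] [L] [h].
have ijk := h.
have jik := triple_off_swap12 ijk.
have ikj := triple_off_swap23 ijk.
have jki := triple_off_swap23 jik.
have kij := triple_off_swap12 ikj.
have kji := triple_off_swap12 jki.
have C := mem_faceC G.
case=> ->.
- apply/compatible_edge_tri1/kills_consistentlyP; split.
  + move=> jk [ij|ik].
      by have [] := g3 j i k L jik; rewrite // C.
    by rewrite C; have [] := g3 k i j L kij; rewrite // C.
  + move=> jk_i [ij|ik].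
      by have [] := g1 j i k L jik; rewrite // C.
    by rewrite C; have [] := g1 k i j L kij; rewrite // C.
  + by move=> jk jk_i; rewrite (C i j) (C i k); apply: g4.
- apply/compatible_edge_tri2/kills_consistentlyP; split.
  + move=> ik [ij|jk_i].
      by have [] := g3 i j k L ijk.
    by rewrite C; have [] := g1 k i j L kij; rewrite // C.
  + move=> ik_j [ij|jk_i].
      by have [] := g1 i j k L ijk.
    by rewrite C; have [] := g2 k i j L kij; rewrite // C.
  (* (G1) for [k, j, i] moves the face [kj|L], which is not in this
     trinomial, to [kj|iL], which is. *)
  + move=> ik ik_j; have [ij|kj] := g4 i k j L ikj ik ik_j; first by left.
    by right; rewrite C; have [] := g1 k j i L kji kj; rewrite // C.
- apply/compatible_edge_tri3/kills_consistentlyP; split.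
  + move=> ij [ik_j|jk_i].
      by have [] := g1 i j k L ijk.
    by rewrite C; have [] := g1 j i k L jik; rewrite // C.
  + move=> ij_k [ik_j|jk_i].
      by have [] := g2 i j k L ijk.
    by rewrite C; have [] := g2 j i k L jik; rewrite // C.
  (* Neither face through [L] that (G4) offers is in this trinomial; (G1) with
     [ij|kL] moves [ik|L] to [ik|jL] and [jk|L] to [jk|iL]. *)
  + move=> ij ij_k; have [ik|jk] := g4 i j k L ijk ij ij_k.
      by left; have [] := g1 i k j L ikj.
    by right; have [] := g1 j k i L jki jk; rewrite // C.
Qed.

(** Each conclusion of an axiom is read off one trinomial that contains it
    together with both premises. *)
Lemma compatible_gaussoid (R : realType) (n : nat) (G : {set face2 n}) :
  (forall f : polyPA R n, edge_trinomial f -> compatible G f) -> gaussoid G.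
Proof.
move=> compat.
have t1 i j k L (h : triple_off i j k L) :
    kills_consistently (mem_face G j k L) (mem_face G j k (i |: L))
      (mem_face G i j L) (mem_face G i k L).
  apply/(compatible_edge_tri1 G R h)/compat.
  by exists i, j, k, L, h; constructor 1.
have t2 i j k L (h : triple_off i j k L) :
    kills_consistently (mem_face G i k L) (mem_face G i k (j |: L))
      (mem_face G i j L) (mem_face G j k (i |: L)).
  apply/(compatible_edge_tri2 G R h)/compat.
  by exists i, j, k, L, h; constructor 2.
have t3 i j k L (h : triple_off i j k L) :
    kills_consistently (mem_face G i j L) (mem_face G i j (k |: L))
      (mem_face G i k (j |: L)) (mem_face G j k (i |: L)).
  apply/(compatible_edge_tri3 G R h)/compat.
  by exists i, j, k, L, h; constructor 3.
split.
- apply/G1P => i j k L h ij ik_j; split.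
    have /kills_consistentlyP[_ v_u _] := t2 i j k L h.
    by apply: v_u => //; left.
  have /kills_consistentlyP[u_v _ _] := t3 i j k L h.
  by apply: u_v => //; left.
- apply/G2P => i j k L h ij_k ik_j; split.
    have /kills_consistentlyP[_ v_u _] := t3 i j k L h.
    by apply: v_u => //; left.
  have /kills_consistentlyP[_ v_u _] := t3 i k j L (triple_off_swap23 h).
  by apply: v_u => //; left.
- apply/G3P => i j k L h ij ik; split.
    have /kills_consistentlyP[u_v _ _] := t2 i k j L (triple_off_swap23 h).
    by apply: u_v => //; left.
  have /kills_consistentlyP[u_v _ _] := t2 i j k L h.
  by apply: u_v => //; left.
- apply/G4P => i j k L h ij ij_k.
  have kij := triple_off_swap12 (triple_off_swap23 h).
  have /kills_consistentlyP[_ _ uv_wx] := t1 k i j L kij.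
  by rewrite (mem_faceC G i k) (mem_faceC G j k); apply: uv_wx.
Qed.

Theorem theorem2p4 (R : realType) (n : nat) (G : {set face2 n}) :
  gaussoid G <-> (forall f : polyPA R n, edge_trinomial f -> compatible G f).
Proof.
by split; [exact: gaussoid_compatible | exact: compatible_gaussoid].
Qed.
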